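(* Let $X$ be a complex Banach space and let $\mathfrak A$ be a subalgebra of $\mathcal L(X)$ such that $\mathfrak A$ has no non-trivial invariant injective operator ranges. Then $\mathfrak A$ is dense in $\mathcal L(X)$ in the weak operator topology.
   Context: $\mathcal L(X)$ is the algebra of all bounded linear operators on $X$; a subalgebra need not be unital or closed. A linear subspace $Y\subseteq X$ is an injective operator range if for some integer $n\geq 1$ there are a closed subspace $\mathcal M\subseteq X^n$ and a one-to-one bounded linear operator $\vec T\colon\mathcal M\to X$ with $Y=\operatorname{Range}\vec T$. $Y$ is invariant for $\mathfrak A$ if $AY\subseteq Y$ for all $A\in\mathfrak A$, and non-trivial if $Y\neq\{0\}$ and $Y\neq X$.
   Formalization: The case where X is one-dimensional and the subalgebra is {0} is excluded: there no non-trivial subspaces exist, so the hypothesis holds vacuously, but {0} is not dense in L(X), so the claim as stated fails. *)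

(* Defs.v *)
From HB Require Import structures.
From mathcomp Require Export all_boot all_order all_algebra.
From mathcomp Require Export complex.
From mathcomp Require Export all_classical all_reals all_analysis.
Export numFieldNormedType.Exports.

Set Implicit Arguments.
Unset Strict Implicit.
Unset Printing Implicit Defensive.

Import Order.TTheory GRing.Theory Num.Theory.
Local Open Scope classical_set_scope.
Local Open Scope ring_scope.

Section BoundedOperators.
Variables (K : numFieldType) (X : normedModType K).

Definition bounded_operators : set {linear X -> X} :=
  [set T | bounded_near T (nbhs (0 : X))].

Definition bounded_operator : Type := set_type bounded_operators.

Definition bop (T : bounded_operator) : {linear X -> X} := \val T.

Lemma bounded_operatorP (T : {linear X -> X}) :
  continuous T -> T \in bounded_operators.
Proof. by move=> cT; rewrite inE; apply/linear_bounded_continuous. Qed.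

Lemma bop_continuous (T : bounded_operator) : continuous (bop T).
Proof. by apply/linear_bounded_continuous; exact: (set_valP T). Qed.

Lemma bop_zero_subproof : (\0 : {linear X -> X}) \in bounded_operators.
Proof. by apply: bounded_operatorP => x; exact: cvg_cst. Qed.

Lemma bop_add_subproof (S T : bounded_operator) :
  (bop S \+ bop T : {linear X -> X}) \in bounded_operators.
Proof.
by apply: bounded_operatorP => x; apply: cvgD; exact: bop_continuous.
Qed.

Lemma bop_scale_subproof (c : K) (T : bounded_operator) :
  (c \*: bop T : {linear X -> X}) \in bounded_operators.
Proof.
by apply: bounded_operatorP => x; apply: cvgZr; exact: bop_continuous.
Qed.

Lemma bop_comp_subproof (S T : bounded_operator) :
  (bop S \o bop T : {linear X -> X}) \in bounded_operators.
Proof.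
apply: bounded_operatorP => x.
by apply: continuous_comp; exact: bop_continuous.
Qed.

Definition bop_zero : bounded_operator := SigSub bop_zero_subproof.
Definition bop_add (S T : bounded_operator) : bounded_operator :=
  SigSub (bop_add_subproof S T).
Definition bop_scale (c : K) (T : bounded_operator) : bounded_operator :=
  SigSub (bop_scale_subproof c T).
Definition bop_comp (S T : bounded_operator) : bounded_operator :=
  SigSub (bop_comp_subproof S T).

Definition is_subalgebra (A : set bounded_operator) : Prop :=
  [/\ A bop_zero,
      forall S T, A S -> A T -> A (bop_add S T),
      forall c T, A T -> A (bop_scale c T) &
      forall S T, A S -> A T -> A (bop_comp S T)].

Definition functional : Type := {f : {linear X -> K^o} | continuous f}.

Definition wot_eval (T : bounded_operator) : {ptws (X * functional) -> K^o} :=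
  fun p => sval p.2 (bop T p.1).

(* The weak operator topology is the coarsest topology making every
   T |-> f (T x) continuous, that is, the initial topology for the map into
   the product of copies of K indexed by the pairs (x, f). *)
Definition wot : Type := initial_topology wot_eval.

End BoundedOperators.

HB.instance Definition _ (K : numFieldType) (X : normedModType K) :=
  Choice.on (bounded_operator X).
HB.instance Definition _ (K : numFieldType) (X : normedModType K) :=
  Topological.copy (wot X) (initial_topology (@wot_eval K X)).

Section OperatorRanges.
Variables (K : numFieldType) (X : normedModType K).

Definition closed_subspace (n : nat) (M : set ('I_n -> X)) : Prop :=
  [/\ M (fun=> 0),
      forall x y, M x -> M y -> M (fun i => x i + y i),
      forall (c : K) x, M x -> M (fun i => c *: x i) &
      closed (M : set {ptws 'I_n -> X})].

(* An operator M -> X is a function on X^n of which only the values on M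
   matter. Boundedness refers to the l^1 norm on X^n, which is equivalent to
   the other usual norms and induces the product topology. *)
Definition injective_bounded_operator_on (n : nat) (M : set ('I_n -> X))
    (T : ('I_n -> X) -> X) : Prop :=
  [/\ forall x y, M x -> M y -> T (fun i => x i + y i) = T x + T y,
      forall (c : K) x, M x -> T (fun i => c *: x i) = c *: T x,
      exists C : K, forall x, M x -> `|T x| <= C * \sum_(i < n) `|x i| &
      forall x y, M x -> M y -> T x = T y -> x = y].

Definition injective_operator_range (Y : set X) : Prop :=
  exists (n : nat) (M : set ('I_n -> X)) (T : ('I_n -> X) -> X),
    [/\ (1 <= n)%N, closed_subspace M, injective_bounded_operator_on M T &
        Y = T @` M].

Definition invariant_range (A : set (bounded_operator X)) (Y : set X) : Prop :=
  forall T, A T -> bop T @` Y `<=` Y.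

Definition nontrivial (Y : set X) : Prop := Y <> [set 0] /\ Y <> setT.

Definition one_dimensional : Prop :=
  exists2 e : X, e <> 0 & forall x, exists c : K, x = c *: e.

End OperatorRanges.

Arguments bop_zero {K} X.
Arguments one_dimensional {K} X.

(* Main.v *)
From HB Require Import structures.
Require Import Defs.
From mathcomp Require Import ring lra cyclic separable cyclotomic.
Set Implicit Arguments.
Unset Strict Implicit.
Unset Printing Implicit Defensive.
Import Order.TTheory GRing.Theory Num.Theory.
Local Open Scope classical_set_scope.
Local Open Scope ring_scope.

(* Let M be a closed A-invariant subspace of X^n. Every linear combination of
   the coordinates that is injective on M has range {0} or X, because this range
   is an invariant injective operator range. If a coordinate m_i is injective on
   M and M <> 0, then M is the graph of operators T_j : m_i |-> m_j defined on
   all of X; the kernel and the range of T_j - c are again invariant injective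
   operator ranges, so either T_j = c or T_j - c is bijective. By the open mapping
   theorem and the non-emptiness of the spectrum, T_j is a scalar.
   A subset t of the indices that is minimal among those supporting a non-zero
   element of M provides such a graph, and splitting it off shows by induction
   that M is the set of solutions of the scalar linear equations
   c_1 m_1 + ... + c_n m_n = 0 that hold on M. Apply this to the closure M of
   {(S x_1, ..., S x_n) : S in A}: such an equation says that S (sum_i c_i x_i) = 0
   for all S in A, so sum_i c_i x_i = 0, and (T x_1, ..., T x_n) is in M for every
   bounded T.
   The spectrum is non-empty for the following reason. If all T - c were
   invertible, the inverse of 1 - z^n T^n, being the mean of the inverses of
   1 - w z T over w^n = 1, would be Lipschitz in z uniformly in n; but for large n
   it jumps from nearly 1 to nearly 0 as |z| crosses a critical radius. *)

(** * Real-valued norms and convergence *)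

Section RealNorm.
Variables (R : realType).

(* The norm `|x| has values in the complex numbers; [nm x] is the same number
   as an element of the totally ordered field [R]. *)
Definition nm (V : normedZmodType R[i]) (x : V) : R := complex.Re `|x|.

Section Zmod.
Variable V : normedZmodType R[i].
Implicit Types x y : V.

Lemma nmE x : `|x| = (nm x)%:C%C.
Proof. by rewrite /nm RRe_real// normr_real. Qed.

Lemma nm_ge0 x : 0 <= nm x.
Proof. by rewrite -ler0c -nmE. Qed.

Lemma nm0 : nm (0 : V) = 0.
Proof. by rewrite /nm normr0. Qed.

Lemma nm_eq0 x : nm x = 0 -> x = 0.
Proof. by move=> x0; apply/normr0_eq0; rewrite nmE x0. Qed.

Lemma nm_gt0 x : x <> 0 -> 0 < nm x.
Proof. by move=> x0; rewrite lt_def nm_ge0 andbT; apply/eqP => /nm_eq0. Qed.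

Lemma nmN x : nm (- x) = nm x.
Proof. by rewrite /nm normrN. Qed.

Lemma nmD x y : nm (x + y) <= nm x + nm y.
Proof. by have := ler_normD x y; rewrite !nmE -rmorphD lecR. Qed.

Lemma nmB x y : nm (x - y) <= nm x + nm y.
Proof. by rewrite -(nmN y) nmD. Qed.

Lemma nm_distC x y : nm (x - y) = nm (y - x).
Proof. by rewrite -nmN opprB. Qed.

Lemma nm_sum (I : Type) (r : seq I) (P : pred I) (F : I -> V) :
  nm (\sum_(i <- r | P i) F i) <= \sum_(i <- r | P i) nm (F i).
Proof.
elim/big_ind2 : _ => [|x a y b xa yb|//]; first by rewrite nm0.
by apply: le_trans (nmD _ _) _; exact: lerD.
Qed.

End Zmod.

Lemma nm1 : nm (1 : R[i]) = 1.
Proof. by rewrite /nm normr1. Qed.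

Lemma nmM (a b : R[i]) : nm (a * b) = nm a * nm b.
Proof. by apply: complexI; rewrite rmorphM -!nmE normrM. Qed.

Lemma nmX (a : R[i]) k : nm (a ^+ k) = nm a ^+ k.
Proof. by elim: k => [|k IH]; rewrite ?expr0 ?nm1// !exprS nmM IH. Qed.

Lemma nmR (a : R) : nm (a%:C%C) = `|a|.
Proof.
by rewrite /nm normc_def /= expr0n addr0 sqrtr_sqr.
Qed.

Lemma nm_complex_le (a b : R) : nm (a +i* b)%C <= `|a| + `|b|.
Proof.
have -> : (a +i* b)%C = a%:C%C + 'i%C * b%:C%C by exact: (complexE (a +i* b)%C).
apply: le_trans (nmD _ _) _; rewrite nmM !nmR lerD2l.
suff -> : nm ('i%C : R[i]) = 1 by rewrite mul1r.
by rewrite /nm normc_def /= expr0n expr1n add0r sqrtr1.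
Qed.

Lemma normRe_le_nm (c : R[i]) : `|complex.Re c| <= nm c.
Proof. by rewrite -lecR -nmE normc_ge_Re. Qed.

Lemma normIm_le_nm (c : R[i]) : `|complex.Im c| <= nm c.
Proof.
rewrite -(normrN (complex.Im c)) -ReiNIm (le_trans (normRe_le_nm _))// nmM.
suff -> : nm ('i%C : R[i]) = 1 by rewrite mulr1.
by rewrite /nm normc_def /= expr0n expr1n add0r sqrtr1.
Qed.

Lemma nmZ (V : normedModType R[i]) (c : R[i]) (x : V) :
  nm (c *: x) = nm c * nm x.
Proof. by have := normrZ c x; rewrite !nmE -rmorphM => /complexI. Qed.

Lemma nm_nbhs (V : normedModType R[i]) (x : V) (e : R) : 0 < e ->
  nbhs x [set y | nm (x - y) < e].
Proof.
move=> e0; apply/nbhs_normP; exists e%:C%C; first by rewrite /= ltcR.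
by move=> y; rewrite /= nmE ltcR.
Qed.

Lemma expr_unbounded (q B : R) : 1 < q -> exists k, B < q ^+ k.
Proof.
move=> q1; have d0 : 0 < q - 1 by rewrite subr_gt0.
exists (Num.truncn (`|B| / (q - 1))).+1; set k := _.+1.
have Bk : `|B| / (q - 1) < k%:R by exact: truncnS_gt.
(* Bernoulli's inequality. *)
have le j : 1 + j%:R * (q - 1) <= q ^+ j.
  elim: j => [|j IH]; first by rewrite mul0r addr0 expr0.
  rewrite exprS -natr1.
  have q0 : 0 <= q by apply: ltW; apply: lt_trans q1.
  apply: le_trans (ler_wpM2l q0 IH).
  have : 0 <= j%:R * (q - 1) ^+ 2 by rewrite mulr_ge0// sqr_ge0.
  lra.
apply: lt_le_trans (le k).
rewrite ltr_pdivrMr// in Bk.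
have := ler_norm B; lra.
Qed.

(** The increments are dominated by a geometric series of ratio 1/2, whose tail from [k] on is at
    most [2 * r k]. Serves both the Baire argument and successive approximation. *)
Lemma shrinking_cvg (X : completeNormedModType R[i]) (u : nat -> X)
    (r : nat -> R) :
  (forall k, r k.+1 <= r k / 2) -> (forall k, nm (u k.+1 - u k) <= r k) ->
  exists l, u @ \oo --> l /\ forall k, nm (l - u k) <= 2 * r k.
Proof.
move=> r2 ur.
have r0 k : 0 <= r k by apply: le_trans (ur k); exact: nm_ge0.
(* Subtracting [r (k + j)] lets the induction close, since [r2] gives r_j <= 2 (r_j - r_(j+1)). *)
have step k j : nm (u (k + j)%N - u k) <= 2 * (r k - r (k + j)%N).
  elim: j => [|j IH]; first by rewrite addn0 !subrr nm0 mulr0.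
  rewrite addnS.
  have -> : u (k + j).+1 - u k = (u (k + j).+1 - u (k + j)%N) + (u (k + j)%N - u k).
    by rewrite addrA subrK.
  apply: le_trans (nmD _ _) _.
  apply: le_trans (lerD (ur _) IH) _.
  have := r2 (k + j)%N; lra.
have step2 k j : (k <= j)%N -> nm (u j - u k) <= 2 * r k.
  move=> kj; have := step k (j - k)%N; rewrite subnKC// => /le_trans; apply.
  by have := r0 j; lra.
have rk k : r k * 2 ^+ k <= r 0%N.
  elim: k => [|k IH]; first by rewrite expr0 mulr1.
  apply: le_trans IH; rewrite exprS mulrA ler_wpM2r ?exprn_ge0//.
  by have := r2 k; lra.
have small e : 0 < e -> exists k, 2 * r k < e.
  move=> e0; have [k kE] := @expr_unbounded 2 (2 * r 0%N / e) (ltr1n R 2).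
  exists k; rewrite -(ltr_pM2r (_ : 0 < 2 ^+ k)) ?exprn_gt0//.
  apply: le_lt_trans (_ : 2 * r 0%N < _); first by rewrite -mulrA ler_wpM2l.
  by rewrite -ltr_pdivrMl// mulrC.
have : cvg (u @ \oo).
  suff : cauchy (u @ \oo) by exact: cauchy_cvg.
  suff : cauchy_ex (u @ \oo) by exact: cauchy_exP.
  move=> e e0.
  have eE : e = (complex.Re e)%:C%C by rewrite RRe_real// gtr0_real.
  have /small[k ke] : 0 < complex.Re e by rewrite -ltcR -eE.
  exists (u k), k => // j /= kj.
  rewrite -ball_normE /= nmE eE ltcR nm_distC.
  exact: le_lt_trans (step2 _ _ kj) ke.
move=> /cvg_ex[l ul]; exists l; split=> // k.
apply/ler_addgt0Pr => e e0.
have : \forall j \near \oo, (nm (l - u j) < e) /\ (k <= j)%N.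
  near=> j; split.
    by near: j; have := ul _ (nm_nbhs l e0).
  by near: j; exists k.
move=> /filter_ex [j [lj kj]].
have -> : l - u k = (l - u j) + (u j - u k) by rewrite addrA subrK.
apply: le_trans (nmD _ _) _; rewrite addrC; apply: lerD; first exact: step2.
exact: ltW.
Unshelve. all: by end_near. Qed.

End RealNorm.

(** * Uniform constants on discs of the complex plane *)

Section ComplexDisc.
Variable R : realType.

(** By monotonicity a local constant may be replaced by any larger one; compactness of the square
    [-B, B]^2, which contains the disc, yields a common one. *)
Lemma disc_uniform (P : R -> R[i] -> Prop) (B : R) :
  (forall K K' c, K <= K' -> P K c -> P K' c) ->
  (forall c, exists K d, 0 < d /\ forall c', nm (c' - c) < d -> P K c') ->
  exists K, forall c, nm c <= B -> P K c.
Proof.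
move=> Pmono Ploc.
pose Q (K : R) (p : R * R) := P K (p.1 +i* p.2)%C.
have /compact_near_coveringP cpt :
    compact ((`[- B, B]%classic : set R) `*` (`[- B, B]%classic : set R)).
  by apply: compact_setX; exact: segment_compact.
have : \forall K \near +oo, (`[- B, B]%classic : set R) `*` `[- B, B]%classic `<=` Q K.
  apply: cpt => -[a b] _; have [K [d [d0 PK]]] := Ploc (a +i* b)%C.
  have d20 : 0 < d / 2 by rewrite divr_gt0.
  exists (ball a (d / 2) `*` ball b (d / 2), [set K' | K <= K']).
    split=> /=.
      by exists (ball a (d / 2), ball b (d / 2)) => //; split; exact: nbhsx_ballx.
    by apply: nbhs_pinfty_ge; exact: num_real.
  move=> [[a' b'] K'] /= [[aa bb] KK]; apply: Pmono KK _; apply: PK.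
  have -> : ((a' +i* b') - (a +i* b) = (a' - a) +i* (b' - b))%C by [].
  apply: le_lt_trans (nm_complex_le _ _) _.
  rewrite [d]splitr; apply: ltrD; rewrite distrC; [exact: aa|exact: bb].
move=> /filter_ex[K KQ]; exists K => -[a b] cB.
by apply: (KQ (a, b)); split; rewrite /= in_itv /= -ler_norml;
  apply: le_trans cB; [exact: normRe_le_nm (a +i* b)%C|exact: normIm_le_nm (a +i* b)%C].
Qed.

End ComplexDisc.

(** * Open mapping theorem for closed subspaces of X^n *)

Section Subspaces.
Variables (R : realType) (X : completeNormedModType R[i]).

(** Closedness in the product topology, in epsilon form for the maximum norm. *)
Definition nclosed n (M : set ('I_n -> X)) : Prop :=
  forall l, (forall e : R, 0 < e -> exists2 m, M m & forall i, nm (l i - m i) < e) ->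
    M l.

Definition nclosed_subspace n (M : set ('I_n -> X)) : Prop :=
  [/\ M (fun=> 0),
      forall x y, M x -> M y -> M (fun i => x i + y i),
      forall c x, M x -> M (fun i => c *: x i) &
      nclosed M].

Lemma nclosed_subspaceP n (M : set ('I_n -> X)) :
  nclosed_subspace M -> closed_subspace M.
Proof.
move=> [M0 MD MZ Mcl]; split=> // l Ml; apply: Mcl => e e0.
have [|m [Mm lm]] := Ml [set m : {ptws 'I_n -> X} | forall i, nm (l i - m i) < e].
  apply: (@filter_forall {ptws 'I_n -> X} _ (fun i m => nm (l i - m i) < e)
    _ (nbhs_filter l)) => i.
  by have := @proj_continuous _ (fun=> X) i l _ (nm_nbhs (l i) e0).
by exists m.
Qed.

Definition comb n (a : 'I_n -> R[i]) (m : 'I_n -> X) : X := \sum_i a i *: m i.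

Definition norm1 n (m : 'I_n -> X) : R := \sum_i nm (m i).

Lemma fun_subr_eq0 n (m m' : 'I_n -> X) : (fun i => m i - m' i) = (fun=> 0) -> m = m'.
Proof.
move=> /funeqP mm'; apply/funext => i; apply/eqP; rewrite -subr_eq0.
by apply/eqP; exact: mm'.
Qed.

Section Comb.
Variables (n : nat) (a : 'I_n -> R[i]).

Lemma combD m m' : comb a (fun i => m i + m' i) = comb a m + comb a m'.
Proof. by rewrite /comb -big_split; apply: eq_bigr => i _; rewrite scalerDr. Qed.

Lemma combZ c m : comb a (fun i => c *: m i) = c *: comb a m.
Proof.
by rewrite /comb scaler_sumr; apply: eq_bigr => i _; rewrite !scalerA mulrC.
Qed.

Lemma combB m m' : comb a (fun i => m i - m' i) = comb a m - comb a m'.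
Proof.
rewrite combD; congr (_ + _); rewrite -scaleN1r -combZ.
by congr comb; apply/funext => i; rewrite scaleN1r.
Qed.

Lemma comb0 : comb a (fun=> 0) = 0.
Proof. by rewrite /comb big1// => i _; rewrite scaler0. Qed.

Lemma nm_le_norm1 (m : 'I_n -> X) i : nm (m i) <= norm1 m.
Proof.
rewrite /norm1 (bigD1 i)//= lerDl; apply: sumr_ge0 => j _; exact: nm_ge0.
Qed.

Lemma norm1_le (m : 'I_n -> X) c : (forall i, nm (m i) <= c) -> norm1 m <= n%:R * c.
Proof.
move=> mc; apply: le_trans (_ : \sum_(i < n) c <= _); first exact: ler_sum.
by rewrite sumr_const card_ord mulr_natl.
Qed.

Lemma norm1D (m m' : 'I_n -> X) : norm1 (fun i => m i + m' i) <= norm1 m + norm1 m'.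
Proof. by rewrite /norm1 -big_split; apply: ler_sum => i _; exact: nmD. Qed.

Lemma norm1Z c (m : 'I_n -> X) : norm1 (fun i => c *: m i) = nm c * norm1 m.
Proof. by rewrite /norm1 mulr_sumr; apply: eq_bigr => i _; exact: nmZ. Qed.

Lemma nm_comb m : nm (comb a m) <= (\sum_i nm (a i)) * norm1 m.
Proof.
apply: le_trans (nm_sum _ _ _) _; rewrite mulr_suml; apply: ler_sum => i _.
by rewrite nmZ ler_wpM2l ?nm_ge0// nm_le_norm1.
Qed.

End Comb.

Lemma nclosed_subspaceB n (M : set ('I_n -> X)) m m' : nclosed_subspace M ->
  M m -> M m' -> M (fun i => m i - m' i).
Proof.
move=> [_ MD MZ _] Mm Mm'; have := MD _ _ Mm (MZ (-1) _ Mm').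
by congr M; apply/funext => i; rewrite scaleN1r.
Qed.

(** Baire's theorem: otherwise nested balls avoiding [F 0], [F 1], ... in turn would shrink to a
    point that no [F k] contains. *)
Lemma baire_cover (F : nat -> set X) : (forall x, exists k, F k x) ->
  exists k x (r : R), 0 < r /\
    forall y, nm (x - y) < r -> forall e : R, 0 < e -> exists2 z, F k z & nm (y - z) < e.
Proof.
move=> Fcov; apply: contrapT => noball.
(* The factor 2 in the last clause matches the bound in [shrinking_cvg], so the limit of the centres
   stays out of [F k]. *)
have avoid (p : nat * (X * R)) : exists q : X * R, 0 < p.2.2 ->
    [/\ 0 < q.2, q.2 <= p.2.2 / 2, nm (q.1 - p.2.1) <= p.2.2 &
        forall z, F p.1 z -> 2 * q.2 < nm (z - q.1)].
  case: p => k [x r] /=; have [r0|] := pselect (0 < r); last first.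
    by move=> nr; exists (x, r).
  apply: contrapT => nq; apply: noball; exists k, x, r; split=> // y xy e e0.
  apply: contrapT => nz; apply: nq.
  exists (y, Num.min (r / 2) (e / 4)) => _ /=; split.
  - by rewrite lt_min !divr_gt0.
  - by rewrite ge_min lexx.
  - by rewrite nm_distC ltW.
  - move=> z Fz; rewrite ltNge; apply/negP => zy; apply: nz; exists z => //.
    rewrite nm_distC; apply: le_lt_trans zy _.
    have : Num.min (r / 2) (e / 4) <= e / 4 by rewrite ge_min lexx orbT.
    lra.
have [f fP] := choice avoid.
pose fix s k := if k is j.+1 then f (j, s j) else (0, 1).
have s0 k : 0 < (s k).2.
  by elim: k => [|k IH] //=; have [] := fP (k, s k) IH.
have [||l [_ lP]] := @shrinking_cvg _ X (fun k => (s k).1) (fun k => (s k).2).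
- by move=> k; have [] := fP (k, s k) (s0 k).
- by move=> k; have [] := fP (k, s k) (s0 k).
have [k Fkl] := Fcov l.
have [_ _ _ /(_ l Fkl)] := fP (k, s k) (s0 k).
by rewrite ltNge; have := lP k.+1; rewrite /= => ->.
Qed.

Section OpenMapping.
Variables (n : nat) (M : set ('I_n -> X)) (a : 'I_n -> R[i]).
Hypothesis Msub : nclosed_subspace M.
Hypothesis onto : forall x, exists2 m, M m & comb a m = x.
Hypothesis inj : forall m, M m -> comb a m = 0 -> m = fun=> 0.

(** By Baire, images of elements of norm at most [k] are dense in a ball around some [x0];
    differences of two approximations reach a ball around 0, and rescaling reaches every [x]. *)
Let approx : exists2 C : R, 0 <= C & forall x, exists m,
  [/\ M m, norm1 m <= C * nm x & nm (x - comb a m) <= nm x / 2].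
Proof.
have [M0 MD MZ _] := Msub.
have [|k [x0 [r [r0 H]]]] := @baire_cover
    (fun k => [set comb a m | m in [set m | M m /\ norm1 m <= k%:R]]).
  move=> x; have [m Mm mx] := onto x.
  exists (Num.truncn (norm1 m)).+1, m => //; split=> //.
  by rewrite ltW// truncnS_gt.
exists (4 * k%:R / r); first by rewrite divr_ge0// ?ltW// mulr_ge0.
move=> x; have [x_eq0|x_neq0] := pselect (x = 0).
  by exists (fun=> 0); rewrite comb0 x_eq0 subr0 nm0 mulr0 mul0r /norm1 big1// => i; rewrite nm0.
have xp := nm_gt0 x_neq0.
(* [t x] has norm r/2, inside the ball. Two errors r/8 add up to r/4, which division by [t] turns
   into half of [nm x]; likewise 2k becomes 4k/r times [nm x]. *)
pose t := r / (2 * nm x).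
have t0 : 0 < t by rewrite divr_gt0// mulr_gt0.
have ti0 : 0 <= t^-1 by rewrite invr_ge0 ltW.
have e0 : 0 < r / 8 by rewrite divr_gt0.
have [|_ [m1 [Mm1 m1k] <-] m1e] := H (x0 + t%:C%C *: x) _ _ e0.
  rewrite opprD addNKr nmN nmZ nmR gtr0_norm// /t invfM.
  rewrite [X in X < _](_ : _ = r / 2); last by field; rewrite gt_eqF.
  by lra.
have [|_ [m2 [Mm2 m2k] <-] m2e] := H x0 _ _ e0; first by rewrite subrr nm0.
exists (fun i => (t^-1)%:C%C *: (m1 i - m2 i)); split.
- by apply: MZ; exact: nclosed_subspaceB.
- rewrite norm1Z nmR (ger0_norm ti0).
  have : norm1 (fun i => m1 i - m2 i) <= 2 * k%:R.
    apply: le_trans (norm1D _ _) _.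
    rewrite /norm1; under [X in _ + X]eq_bigr do rewrite nmN.
    by rewrite -/(norm1 m1) -/(norm1 m2); lra.
  move=> /(ler_wpM2l ti0) /le_trans; apply.
  rewrite [leLHS](_ : _ = 4 * k%:R / r * nm x)// /t.
  by field; rewrite !gt_eqF.
- have tC : t%:C%C != 0 :> R[i] by rewrite eq_complex /= eqxx andbT gt_eqF.
  have -> : x - comb a (fun i => (t^-1)%:C%C *: (m1 i - m2 i)) =
      (t^-1)%:C%C *: ((x0 + t%:C%C *: x - comb a m1) - (x0 - comb a m2)).
    rewrite combZ combB fmorphV /=.
    apply: (scalerI tC); rewrite scalerA divff// scale1r scalerBr scalerA divff// scale1r.
    rewrite !opprB [x0 + _]addrC -!addrA; congr (_ + _).
    by rewrite [RHS]addrC -!addrA addNr addr0 addrC.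
  rewrite nmZ nmR (ger0_norm ti0).
  have /(ler_wpM2l ti0) :
      nm (x0 + t%:C%C *: x - comb a m1 - (x0 - comb a m2)) <= r / 4.
    by apply: le_trans (nmB _ _) _; lra.
  move=> /le_trans; apply.
  rewrite [leLHS](_ : _ = nm x / 2)// /t.
  by field; rewrite !gt_eqF.
Qed.

(** Applying [approx] to the successive residues gives corrections that sum to some [l] in the
    closed space [M] with the same image as [m]; injectivity gives l = m. *)
Lemma comb_bounded_below : exists2 K : R, 0 < K &
  forall m, M m -> norm1 m <= K * nm (comb a m).
Proof.
have [M0 MD MZ Mcl] := Msub; have [C C0 /choice[f fP]] := approx.
(* Each of the [n] coordinates is at most 2 C times [nm x]; the summand 1 keeps the constant
   positive. *)
exists (n%:R * (2 * C) + 1).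
  by rewrite ltr_wpDl// !mulr_ge0.
move=> m Mm; set x := comb a m.
pose fix res k := if k is j.+1 then res j - comb a (f (res j)) else x.
pose fix p k : 'I_n -> X := if k is j.+1 then fun i => p j i + f (res j) i else fun=> 0.
have resE k : comb a (p k) = x - res k.
  elim: k => [|k IH]; first by rewrite [LHS]comb0 subrr.
  by rewrite [LHS]combD IH /= opprB addrA addrAC.
have Mp k : M (p k).
  elim: k => [|k IH]; first exact: M0.
  by apply: MD IH _; have [] := fP (res k).
pose r k := C * nm x * 2^-1 ^+ k.
have res_le k : nm (res k) <= nm x * 2^-1 ^+ k.
  elim: k => [|k IH]; first by rewrite expr0 mulr1.
  have [_ _ /le_trans] := fP (res k); apply.
  by rewrite exprSr mulrA ler_wpM2r.
have p_cvg i : exists l, forall k, nm (l - p k i) <= 2 * r k.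
  have [||l [_ lP]] := @shrinking_cvg _ X (fun k => p k i) r; last by exists l.
    by move=> k; rewrite /r exprSr mulrA.
  move=> k /=; rewrite addrC addKr; have [_ fk _] := fP (res k).
  apply: le_trans (nm_le_norm1 _ _) _; apply: le_trans fk _.
  by rewrite /r -mulrA ler_wpM2l.
have [l lP] := choice p_cvg.
have small (e c : R) : 0 < e -> exists k, c * 2^-1 ^+ k < e.
  move=> e0; have [k kc] := @expr_unbounded R 2 (c / e) (ltr1n R 2).
  by exists k; rewrite exprVn ltr_pdivrMr ?exprn_gt0// -ltr_pdivrMl// mulrC.
have Ml : M l.
  apply: Mcl => e e0; have [k kc] := small e (2 * (C * nm x)) e0.
  by exists (p k) => // i; apply: le_lt_trans (lP i k) _; rewrite /r mulrA.
have lx : comb a l = x.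
  apply/eqP; rewrite -subr_eq0; apply/eqP; apply: contrapT => /nm_gt0 /small.
  (* For every [k], [D * 2^-1 ^+ k] bounds the distance from [comb a l] to [x], by way of the
     partial sum [p k]. *)
  pose D := (\sum_i nm (a i)) * (n%:R * (2 * (C * nm x))) + nm x.
  move=> /(_ D)[k]; rewrite ltNge => /negP; apply.
  have -> : comb a l - x = comb a (fun i => l i - p k i) - res k.
    by rewrite combB resE opprB addrA addrAC addrK.
  apply: le_trans (nmB _ _) _; rewrite /D mulrDl; apply: lerD => //.
  apply: le_trans (nm_comb _ _) _; rewrite -mulrA ler_wpM2l//.
    by apply: sumr_ge0 => i _; exact: nm_ge0.
  rewrite -mulrA; apply: norm1_le => i; apply: le_trans (lP i k) _.
  by rewrite /r !mulrA.
have lm : l = m.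
  apply: fun_subr_eq0; apply: inj (nclosed_subspaceB Msub Ml Mm) _.
  by rewrite combB lx subrr.
apply: le_trans (_ : n%:R * (2 * (C * nm x)) <= _).
  rewrite -lm; apply: norm1_le => i; have := lP i 0%N.
  by rewrite subr0 /r expr0 mulr1.
by rewrite [leRHS](_ : _ = n%:R * (2 * (C * nm x)) + nm x) ?lerDl ?nm_ge0 ?/x; ring.
Qed.

End OpenMapping.
End Subspaces.

(** * Non-emptiness of the spectrum *)

Section RootsOfUnity.
Variable F : closedFieldType.

(** As n is non-zero in [F], ['X^n - 1] is separable; n distinct n-th roots of unity include a
    primitive one. *)
Lemma closed_prim_root_exists n : (0 < n)%N -> n%:R != 0 :> F ->
  exists w : F, n.-primitive_root w.
Proof.
move=> n_gt0 n_neq0; pose p : {poly F} := 'X^n - 1.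
have [r Dp] := closed_field_poly_normal p.
move: Dp; rewrite (monicP _) ?monicXnsubC// scale1r => Dp.
have rn1 : all n.-unity_root r by apply/allP=> z; rewrite -root_prod_XsubC -Dp.
have sz_r : (n < (size r).+1)%N.
  by rewrite -(size_prod_XsubC r id) -Dp size_XnsubC.
have [|z] := hasP (has_prim_root n_gt0 rn1 _ sz_r); last by exists z.
by rewrite -separable_prod_XsubC -Dp separable_Xn_sub_1.
Qed.

Lemma prim_root_sum_expr n (w : F) j : n.-primitive_root w -> (0 < j < n)%N ->
  \sum_(k < n) (w ^+ k) ^+ j = 0.
Proof.
move=> wn /andP[j0 jn]; under eq_bigr do rewrite exprAC.
have : (w ^+ j - 1) * (\sum_(k < n) (w ^+ j) ^+ k) = 0.
  by rewrite -subrX1 exprAC (prim_expr_order wn) expr1n subrr.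
move/eqP; rewrite mulf_eq0 subr_eq0 => /orP[/eqP wj1|/eqP//].
by have := prim_order_dvd wn j; rewrite wj1 eqxx gtnNdvd.
Qed.

End RootsOfUnity.

(** * Averages of resolvents over roots of unity *)

Section Resolvent.
Variables (R : realType) (X : normedModType R[i]) (T : {linear X -> X}).

Fixpoint lpow (n : nat) : {linear X -> X} :=
  if n is k.+1 then T \o lpow k else idfun.

Lemma lpowT n x : lpow n (T x) = T (lpow n x).
Proof. by elim: n => [|n IH] //=; rewrite IH. Qed.

(** The truncated Neumann series, equal to (1 - z^n T^n)(1 - z T)^-1 when 1 - z T is invertible. *)
Definition geom (z : R[i]) n x := \sum_(j < n) z ^+ j *: lpow j x.

Lemma geom_sub z n x : geom z n (x - z *: T x) = x - z ^+ n *: lpow n x.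
Proof.
rewrite /geom; elim: n => [|n IH]; first by rewrite big_ord0 scale1r subrr.
rewrite big_ord_recr /= IH linearB [lpow n (z *: _)]linearZ /= lpowT scalerBr scalerA -exprSr.
by rewrite addrA subrK.
Qed.

Lemma geomT z n x : geom z n (T x) = T (geom z n x).
Proof.
by rewrite /geom linear_sum; apply: eq_bigr => j _; rewrite linearZ /= lpowT.
Qed.

Lemma geomB z n x y : geom z n (x - y) = geom z n x - geom z n y.
Proof.
by rewrite /geom -sumrB; apply: eq_bigr => j _; rewrite linearB scalerBr.
Qed.

Lemma geomZ z n c x : geom z n (c *: x) = c *: geom z n x.
Proof.
rewrite /geom scaler_sumr; apply: eq_bigr => j _.
by rewrite linearZ /= !scalerA mulrC.
Qed.

Lemma sub_geom z n x : geom z n x - z *: T (geom z n x) = x - z ^+ n *: lpow n x.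
Proof. by rewrite -geom_sub geomB geomZ geomT. Qed.

(** Summing over the roots of unity kills the powers z^j T^j with 0 < j < n and leaves n copies of
    the constant term. *)
Lemma geom_mean n w z x : (0 < n)%N -> n.-primitive_root w ->
  \sum_(k < n) geom (w ^+ k * z) n x = n%:R *: x.
Proof.
case: n => // n _ wn; rewrite /geom exchange_big /= big_ord_recl /=.
rewrite [X in _ + X]big1 ?addr0.
  under eq_bigr do rewrite expr0 scale1r.
  by rewrite sumr_const card_ord scaler_nat.
move=> j _; rewrite -scaler_suml.
under eq_bigr do rewrite exprMn.
rewrite -mulr_suml prim_root_sum_expr ?mul0r ?scale0r//.
by rewrite /bump /= add1n !ltnS ltn_ord.
Qed.

Variables (C K Z : R).
Hypotheses (C_ge0 : 0 <= C) (K_ge0 : 0 <= K).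
Hypothesis T_bounded : forall x, nm (T x) <= C * nm x.
Hypothesis below : forall z x, nm z <= Z -> nm x <= K * nm (x - z *: T x).
Hypothesis onto : forall z x, nm z <= Z -> exists y, y - z *: T y = x.

(* The inverse of [1 - z^n T^n] is the mean of the inverses of [1 - w^k z T]
   over the [n]-th roots of unity [w^k], so it varies with [z] at a rate that
   does not depend on [n]. *)
Lemma mean_resolvent_lipschitz n z z' y' : (0 < n)%N -> nm z <= Z -> nm z' <= Z ->
  let x := y' - z' ^+ n *: lpow n y' in
  exists2 y, y - z ^+ n *: lpow n y = x &
    nm (y' - y) <= K ^+ 2 * C * nm (z' - z) * nm x.
Proof.
move=> n0 zZ z'Z x.
have nC : n%:R != 0 :> R[i] by rewrite pnatr_eq0 -lt0n.
have [w wn] := closed_prim_root_exists n0 nC.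
have nw k : nm (w ^+ k) = 1.
  have /eqP : nm w ^+ n = 1 by rewrite -nmX (prim_expr_order wn) nm1.
  by rewrite pexpr_eq1 ?nm_ge0// nmX => /eqP ->; rewrite expr1n.
have wk k c : (w ^+ k * c) ^+ n = c ^+ n.
  by rewrite exprMn exprAC (prim_expr_order wn) expr1n mul1r.
have solve (k : 'I_n) : exists y, y - (w ^+ k * z) *: T y = x.
  by apply: onto; rewrite nmM nw mul1r.
have [y yP] := choice solve.
pose mean (u : 'I_n -> X) := n%:R^-1 *: \sum_k u k.
(* 1 - z^n T^n maps [y k] to [geom (w ^+ k * z) n x] by [geom_sub], and these average to [x] by
   [geom_mean]. *)
exists (mean y).
  rewrite /mean [lpow n (_ *: _)]linearZ /= scalerA [_ * n%:R^-1]mulrC -scalerA -scalerBr.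
  rewrite [lpow n (\sum_k _)]linear_sum scaler_sumr -sumrB.
  under eq_bigr => k _ do rewrite -(wk k) -geom_sub yP.
  by rewrite (geom_mean _ _ n0 wn) scalerA mulVf// scale1r.
(* [y'] is itself a mean, of solutions of the equations with [z'] for [z] and the same right-hand
   side. *)
have -> : y' = mean (fun k => geom (w ^+ k * z') n y').
  by rewrite /mean (geom_mean _ _ n0 wn) scalerA mulVf// scale1r.
rewrite /mean -scalerBr -sumrB nmZ.
have -> : nm (n%:R^-1 : R[i]) = n%:R^-1.
  have -> : n%:R^-1 = (n%:R^-1)%:C%C :> R[i] by rewrite fmorphV /= rmorph_nat.
  by rewrite nmR ger0_norm.
rewrite mulrC ler_pdivrMr ?ltr0n//.
apply: le_trans (nm_sum _ _ _) _.
apply: le_trans (_ : \sum_(k < n) K ^+ 2 * C * nm (z' - z) * nm x <= _); last first.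
  by rewrite sumr_const card_ord mulr_natr.
apply: ler_sum => k _; set v := geom _ _ _.
have vx : v - (w ^+ k * z') *: T v = x by rewrite sub_geom wk.
have vK : nm v <= K * nm x by rewrite -vx; apply: below; rewrite nmM nw mul1r.
apply: le_trans (@below (w ^+ k * z) (v - y k) _) _; first by rewrite nmM nw mul1r.
(* Resolvent identity: it costs a factor [K] for each of two inverses and a factor [C] for [T]. *)
have -> : v - y k - (w ^+ k * z) *: T (v - y k) = (w ^+ k * (z' - z)) *: T v.
  have -> : v - y k - (w ^+ k * z) *: T (v - y k) =
      v - (w ^+ k * z) *: T v - (y k - (w ^+ k * z) *: T (y k)).
    by rewrite linearB scalerBr !opprB addrACA [RHS]addrACA [- y k - _]addrC.
  by rewrite yP -vx opprB addrC addrA subrK -scalerBl mulrBr.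
rewrite nmZ nmM nw mul1r expr2 -!mulrA ler_wpM2l//.
rewrite [leRHS](_ : _ = nm (z' - z) * (C * (K * nm x))); last by ring.
rewrite ler_wpM2l ?nm_ge0//; apply: le_trans (T_bounded _) _.
by rewrite ler_wpM2l.
Qed.

End Resolvent.

(** * Carrying the smallness of z^n T^n to larger radii *)

Section Spectrum.
Variables (R : realType) (X : normedModType R[i]) (T : {linear X -> X}).

Section Jump.
Variables (C K Z : R).
Hypotheses (C_ge0 : 0 <= C) (K_ge0 : 0 <= K).
Hypothesis T_bounded : forall x, nm (T x) <= C * nm x.
Hypothesis below : forall z x, nm z <= Z -> nm x <= K * nm (x - z *: T x).
Hypothesis onto : forall z x, nm z <= Z -> exists y, y - z *: T y = x.

(** The solution [y] of y - z^n T^n y = u is within |u|/8 of [x] and within |y|/9 <= |u|/8 of [u].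
    So |x - u| <= |u|/4, hence |x - u| <= |x|/3. *)
Lemma pow_jump n (z z' : R) : (0 < n)%N -> 0 <= z <= z' -> z' <= Z ->
  K ^+ 2 * C * (z' - z) <= 1 / 8 ->
  (forall x, z ^+ n * nm (lpow T n x) <= 1 / 9 * nm x) ->
  forall x, z' ^+ n * nm (lpow T n x) <= 1 / 3 * nm x.
Proof.
move=> n0 /andP[z0 zz'] z'Z small zn x.
have z'0 : 0 <= z' by apply: le_trans zz'.
have nz : nm (z%:C%C : R[i]) = z by rewrite nmR ger0_norm.
have nz' : nm (z'%:C%C : R[i]) = z' by rewrite nmR ger0_norm.
have := @mean_resolvent_lipschitz _ _ T C K Z C_ge0 K_ge0 T_bounded below onto
  n z%:C%C z'%:C%C x n0.
rewrite nz nz' => /(_ (le_trans zz' z'Z) z'Z) /=.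
set u := x - _ => -[y yu].
have -> : nm (z'%:C%C - z%:C%C : R[i]) = z' - z.
  by rewrite -rmorphB nmR ger0_norm// subr_ge0.
move=> xy.
have {small}xy : nm (x - y) <= 1 / 8 * nm u.
  by apply: le_trans xy _; rewrite ler_wpM2r// nm_ge0.
have yu9 : nm (y - u) <= 1 / 9 * nm y.
  by rewrite -yu opprB addrC subrK nmZ nmX nz; exact: zn.
have xu : nm (x - u) = z' ^+ n * nm (lpow T n x).
  by rewrite /u opprB addrC subrK nmZ nmX nz'.
rewrite -xu.
have := nmD (x - y) (y - u); rewrite addrA subrK => xyu.
have := nmD (y - u) u; rewrite subrK => yyu.
have := nmB x (x - u); rewrite opprB addrC subrK => uxu.
lra.
Qed.

End Jump.

(** A lower bound for 1 - z T survives small changes of [z], so compactness of the disc applies. For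
    non-zero [z] it comes from T - z^-1. *)
Lemma resolvent_bounded (C Z : R) : 0 <= C ->
  (forall x, nm (T x) <= C * nm x) ->
  (forall c, exists K, forall x, nm x <= K * nm (T x - c *: x)) ->
  exists2 K, 0 <= K & forall z x, nm z <= Z -> nm x <= K * nm (x - z *: T x).
Proof.
move=> C0 Tb Tbelow.
have [||K KP] := @disc_uniform R
    (fun K z => forall x, nm x <= K * nm (x - z *: T x)) Z.
- move=> K K' z KK' zK x; apply: le_trans (zK x) _.
  by rewrite ler_wpM2r// nm_ge0.
- move=> z.
  have [K K0 KP] : exists2 K, 0 < K & forall x, nm x <= K * nm (x - z *: T x).
    have [->|z0] := eqVneq z 0.
      by exists 1 => // x; rewrite scale0r subr0 mul1r.
    have [K KP] := Tbelow z^-1.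
    have nz0 : 0 < nm z by apply: nm_gt0; exact/eqP.
    exists ((`|K| + 1) / nm z); first by rewrite divr_gt0// ltr_pwDr.
    move=> x; have -> : x - z *: T x = - (z *: (T x - z^-1 *: x)).
      by rewrite scalerBr scalerA divff// scale1r opprB.
    rewrite nmN nmZ mulrA divfK ?gt_eqF//; apply: le_trans (KP x) _.
    by rewrite ler_wpM2r ?nm_ge0//; have := ler_norm K; lra.
  have C1 : 0 < C + 1 by lra.
  (* Within this radius the perturbation absorbs at most half of [nm x], so doubling [K]
     suffices. *)
  exists (2 * K), (2 * K * (C + 1))^-1; split; first by rewrite invr_gt0 !mulr_gt0.
  move=> z' zz' x.
  have xE : nm (x - z *: T x) <= nm (x - z' *: T x) + nm (z' - z) * (C * nm x).
    have -> : x - z *: T x = x - z' *: T x + (z' - z) *: T x.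
      by rewrite scalerBl addrA subrK.
    apply: le_trans (nmD _ _) _; rewrite lerD2l nmZ ler_wpM2l ?nm_ge0//.
  have dx : nm (z' - z) * (C * nm x) <= (2 * K)^-1 * nm x.
    rewrite mulrA ler_wpM2r ?nm_ge0//.
    apply: le_trans (_ : nm (z' - z) * (C + 1) <= _).
      by rewrite ler_wpM2l ?nm_ge0// lerDl.
    by rewrite -ler_pdivlMr// -invfM; exact: ltW.
  have := KP x => /le_trans /(_ (ler_wpM2l (ltW K0) (le_trans xE (lerD (lexx _) dx)))).
  rewrite mulrDr mulrA invfM [K * (_ * _)]mulrC divfK ?gt_eqF//; lra.
exists `|K| => // z x /KP /(_ x) /le_trans; apply.
by rewrite ler_wpM2r ?nm_ge0// ler_norm.
Qed.

Theorem spectrum_nonempty (C : R) (x0 : X) : x0 <> 0 ->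
  (forall x, nm (T x) <= C * nm x) ->
  (forall c, exists K, forall x, nm x <= K * nm (T x - c *: x)) ->
  ~ (forall c y, exists x, T x - c *: x = y).
Proof.
move=> /nm_gt0 x0_gt0 T_bounded T_below T_onto.
have C0 : 0 <= C by have := le_trans (nm_ge0 _) (T_bounded x0); rewrite pmulr_lge0.
have [D0 D0P] := T_below 0; pose D := `|D0| + 1.
have D1 : 1 <= D by rewrite lerDr.
have DP x : nm x <= D * nm (T x).
  have := D0P x; rewrite scale0r subr0 => /le_trans; apply.
  by rewrite ler_wpM2r ?nm_ge0//; have := ler_norm D0; rewrite /D; lra.
(* Each step starts at some z <= D and looks ahead to z q^2 <= 4 D. *)
pose Z := 4 * D.
have [K K0 KP] := resolvent_bounded Z C0 T_bounded T_below.
have onto z x : nm z <= Z -> exists y, y - z *: T y = x.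
  move=> _; have [->|z0] := eqVneq z 0; first by exists x; rewrite scale0r subr0.
  have [y yx] := T_onto z^-1 (- z^-1 *: x); exists y.
  apply: (scalerI (_ : - z^-1 != 0)); first by rewrite oppr_eq0 invr_eq0.
  by rewrite -yx scalerBr scalerA mulNr mulVf// scaleN1r opprK scaleNr addrC.
pose E := K ^+ 2 * C * Z.
have E0 : 0 <= E by rewrite /E /Z !mulr_ge0 ?exprn_ge0//; lra.
(* [E (q ^+ 2 - 1)] bounds the rate of [mean_resolvent_lipschitz] from [z <= Z] to [z q^2]. *)
pose q := 1 + (8 * (E + 1) * 4)^-1.
have d0 : 0 < (8 * (E + 1) * 4)^-1 by rewrite invr_gt0; lra.
have dE : (8 * (E + 1) * 4)^-1 * (8 * (E + 1) * 4) = 1 by rewrite mulVf// gt_eqF//; lra.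
have q1 : 1 < q by rewrite /q; lra.
have q2 : q <= 2.
  rewrite /q; nra.
have Eq : E * (q ^+ 2 - 1) <= 1 / 8.
  rewrite /q in q2 *; move: d0 dE q2; set d := _^-1 => d0 dE q2; nra.
(* [q] does not depend on [n], so [n] may be chosen after it. *)
have [n [n0 qn]] : exists n, (0 < n)%N /\ 3 < q ^+ n.
  have [n nq] := expr_unbounded 3 q1; exists n; split=> //.
  by case: n nq => // ; rewrite expr0; lra.
(* Makes [z0 * C] at most 1/9; [C + 1] avoids division by 0. *)
pose z0 := (9 * (C + 1))^-1.
have z0_gt0 : 0 < z0 by rewrite invr_gt0; lra.
have z0E : z0 * (9 * (C + 1)) = 1 by rewrite mulVf// gt_eqF//; lra.
pose H z := forall x, z ^+ n * nm (lpow T n x) <= 1 / 9 * nm x.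
have Hz0 : H z0.
  move=> x; have zC : 0 <= z0 * C by rewrite mulr_ge0// ltW.
  have zC9 : z0 * C <= 1 / 9 by lra.
  have Cn k : nm (lpow T k x) <= C ^+ k * nm x.
    elim: k => [|k IH] /=; first by rewrite mul1r.
    by apply: le_trans (T_bounded _) _; rewrite exprS -mulrA ler_wpM2l.
  apply: le_trans (ler_wpM2l (exprn_ge0 n (ltW z0_gt0)) (Cn n)) _.
  rewrite mulrA -exprMn ler_wpM2r ?nm_ge0//; apply: le_trans zC9.
  by rewrite -(prednK n0) exprS ler_piMr// exprn_ile1//; lra.
(* [pow_jump] gives the bound 1/3 at z q^2; going back to z q gains q^-n < 1/3, which restores
   1/9. *)
have Hstep z : 0 <= z -> z <= D -> H z -> H (z * q).
  move=> z_ge0 zD Hz x.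
  have qq : 1 <= q ^+ 2 by rewrite exprn_ege1// ltW.
  have qq4 : q ^+ 2 <= 4.
    have : q * q <= 2 * 2 by apply: ler_pM => //; lra.
    by rewrite expr2; lra.
  have zq : 0 <= z <= z * q ^+ 2 by rewrite z_ge0/= ler_peMr.
  have zqZ : z * q ^+ 2 <= Z by rewrite /Z [leRHS]mulrC; apply: ler_pM => //; lra.
  have small : K ^+ 2 * C * (z * q ^+ 2 - z) <= 1 / 8.
    apply: le_trans Eq; rewrite /E -[leRHS]mulrA ler_wpM2l//.
      by rewrite mulr_ge0// exprn_ge0.
    rewrite [leLHS](_ : _ = z * (q ^+ 2 - 1)); last by ring.
    by rewrite ler_wpM2r// /Z; lra.
  have := pow_jump C0 K0 T_bounded KP onto n0 zq zqZ small Hz x.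
  rewrite expr2 mulrA [(_ * q) ^+ n]exprMn.
  set a := (z * q) ^+ n; set b := nm (lpow T n x) => ab.
  have a0 : 0 <= a by rewrite exprn_ge0// mulr_ge0//; lra.
  have : 3 * (a * b) <= q ^+ n * (a * b).
    by apply: ler_wpM2r (ltW qn); rewrite mulr_ge0 ?nm_ge0.
  have := nm_ge0 x; lra.
(* The first radius beyond [D] is reached by steps from radii at most [D]. There [H] contradicts
   [DnP]. *)
have [|j jD jmin] := @ex_minnP (fun j => D < z0 * q ^+ j).
  have [j jq] := expr_unbounded (D / z0) q1; exists j.
  by rewrite mulrC -ltr_pdivrMr.
have /(_ j (leqnn _) x0) : forall i, (i <= j)%N -> H (z0 * q ^+ i).
  elim=> [|i IH] ij; first by rewrite expr0 mulr1.
  rewrite exprSr mulrA; apply: Hstep.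
  - by rewrite mulr_ge0 ?ltW// exprn_gt0//; lra.
  - by rewrite leNgt; apply/negP => /jmin; rewrite leqNgt ij.
  - exact: IH (ltnW ij).
have DnP k : nm x0 <= D ^+ k * nm (lpow T k x0).
  elim: k => [|k IH]; first by rewrite mul1r.
  apply: le_trans IH _; rewrite exprSr -mulrA ler_wpM2l ?DP// exprn_ge0//; lra.
have : D ^+ n * nm (lpow T n x0) <= (z0 * q ^+ j) ^+ n * nm (lpow T n x0).
  rewrite ler_wpM2r ?nm_ge0// lerXn2r// ?nnegrE; [|lra|lra].
  by lra.
have := DnP n; lra.
Qed.

End Spectrum.

(** * Closed invariant subspaces of X^n *)

Section InvariantSubspaces.
Variables (R : realType) (X : completeNormedModType R[i]).
Variable A : set (bounded_operator X).

Definition op_invariant n (M : set ('I_n -> X)) : Prop :=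
  forall S m, A S -> M m -> M (fun i => bop S (m i)).

Lemma bop_comb n (a : 'I_n -> R[i]) S (m : 'I_n -> X) :
  bop S (comb a m) = comb a (fun i => bop S (m i)).
Proof.
by rewrite /comb linear_sum; apply: eq_bigr => i _; rewrite linearZ.
Qed.

Definition coord n (i j : 'I_n) : R[i] := (j == i)%:R.

Lemma comb_coord n (i : 'I_n) (m : 'I_n -> X) : comb (coord i) m = m i.
Proof.
rewrite /comb (bigD1 i)//= /coord eqxx scale1r big1 ?addr0// => j /negPf ->.
by rewrite scale0r.
Qed.

Lemma comb_lin n (a b : 'I_n -> R[i]) c (m : 'I_n -> X) :
  comb (fun i => a i - c * b i) m = comb a m - c *: comb b m.
Proof.
rewrite /comb scaler_sumr -sumrB; apply: eq_bigr => i _.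
by rewrite scalerBl scalerA.
Qed.

(** Scalar equations commute with operators, so cutting by them preserves invariance as well as
    closedness. *)
Definition annihilated n (M : set ('I_n -> X)) (D : set ('I_n -> R[i])) :=
  [set m | M m /\ forall a, D a -> comb a m = 0].

Lemma nclosed_annihilated n (M : set ('I_n -> X)) D : nclosed_subspace M ->
  nclosed_subspace (annihilated M D).
Proof.
move=> [M0 MD MZ Mcl]; split=> /=.
- by split=> // a _; rewrite comb0.
- move=> x y [Mx ax] [My ay]; split=> [|a Da]; first exact: MD.
  by rewrite combD ax// ay// addr0.
- move=> c x [Mx ax]; split=> [|a Da]; first exact: MZ.
  by rewrite combZ ax// scaler0.
- move=> l lP; split=> [|a Da].
    by apply: Mcl => e /lP[m [Mm _] ml]; exists m.
  apply: contrapT => /nm_gt0 l0.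
  pose N := \sum_i nm (a i).
  have N0 : 0 <= N by apply: sumr_ge0 => i _; exact: nm_ge0.
  pose B := N * n%:R + 1.
  have B0 : 0 < B by rewrite ltr_wpDl// mulr_ge0.
  have [|m [_ /(_ a Da) am] ml] := lP (nm (comb a l) / B); first by rewrite divr_gt0.
  have : nm (comb a (fun i => l i - m i)) <= N * (n%:R * (nm (comb a l) / B)).
    apply: le_trans (nm_comb _ _) _; rewrite ler_wpM2l//.
    by apply: norm1_le => i; exact: ltW (ml i).
  rewrite combB am subr0 [X in _ <= X -> _](_ : _ = (B - 1) * (nm (comb a l) / B)).
    rewrite mulrBl mul1r [B * _]mulrC divfK ?gt_eqF//.
    have : 0 < nm (comb a l) / B by rewrite divr_gt0.
    lra.
  by rewrite /B addrK mulrA.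
Qed.

Lemma op_invariant_annihilated n (M : set ('I_n -> X)) D : op_invariant M ->
  op_invariant (annihilated M D).
Proof.
move=> Minv S m AS [Mm am]; split=> [|a Da]; first exact: Minv.
by rewrite -bop_comb am// linear0.
Qed.

Hypothesis A_no_range : ~ exists Y : set X,
  [/\ injective_operator_range Y, invariant_range A Y & nontrivial Y].

(** Operators commute with scalar combinations, so the range is invariant; injectivity on [M] makes
    it an injective operator range. *)
Lemma comb_range_trivial n (M : set ('I_n -> X)) a : (0 < n)%N ->
  nclosed_subspace M -> op_invariant M ->
  (forall m, M m -> comb a m = 0 -> m = fun=> 0) ->
  (forall m, M m -> comb a m = 0) \/ (forall x, exists2 m, M m & comb a m = x).
Proof.
move=> n0 Msub Minv inj; have [M0 MD MZ Mcl] := Msub.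
have [Y0|Y0] := pselect (comb a @` M = [set 0]).
  by left=> m Mm; have : (comb a @` M) (comb a m) by [exists m]; rewrite Y0.
have [YT|YT] := pselect (comb a @` M = setT).
  right=> x; have : (comb a @` M) x by rewrite YT.
  by case=> m Mm <-; exists m.
exfalso; apply: A_no_range; exists (comb a @` M); split=> //; last first.
  move=> S AS _ [_ [m Mm <-] <-]; exists (fun i => bop S (m i)); first exact: Minv.
  by rewrite -bop_comb.
exists n, M, (comb a); split=> //; first exact: nclosed_subspaceP.
split=> [x y _ _|c x _||x y Mx My xy].
- exact: combD.
- exact: combZ.
- exists (\sum_i nm (a i))%:C%C => x _.
  rewrite nmE [X in _ * X](_ : _ = (norm1 x)%:C%C).
    by rewrite -rmorphM lecR nm_comb.
  by rewrite /norm1 rmorph_sum; apply: eq_bigr => i _; rewrite nmE.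
- apply: fun_subr_eq0; apply: inj (nclosed_subspaceB Msub Mx My) _.
  by rewrite combB xy subrr.
Qed.

Lemma coordinate_ratio n (M : set ('I_n -> X)) i j :
  nclosed_subspace M -> op_invariant M ->
  (forall m, M m -> m i = 0 -> m = fun=> 0) ->
  exists c, forall m, M m -> m j = c *: m i.
Proof.
move=> Msub Minv inj; have [M0 MD MZ Mcl] := Msub.
have n0 : (0 < n)%N := leq_ltn_trans (leq0n i) (ltn_ord i).
apply: contrapT => nscalar.
pose a c : 'I_n -> R[i] := fun k => coord j k - c * coord i k.
have aE c (m : 'I_n -> X) : comb (a c) m = m j - c *: m i by rewrite /a comb_lin !comb_coord.
have nscal c : ~ forall m, M m -> comb (a c) m = 0.
  move=> H; apply: nscalar; exists c => m /H; rewrite aE => /eqP.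
  by rewrite subr_eq0 => /eqP.
have inj_i m : M m -> comb (coord i) m = 0 -> m = fun=> 0.
  by move=> Mm; rewrite comb_coord; exact: inj.
(* If the [i]-th coordinates of the kernel filled X, the kernel would be all of [M], as [m i]
   determines [m]; this contradicts [nscal]. *)
have ker c m : M m -> comb (a c) m = 0 -> m = fun=> 0.
  have [|N0|NT] := comb_range_trivial n0 (nclosed_annihilated [set a c] Msub)
      (op_invariant_annihilated (D := [set a c]) Minv) (a := coord i).
  - by move=> m' [Mm' _]; exact: inj_i.
  - by move=> Mm am; apply: inj_i => //; apply: N0; split=> // _ ->.
  - exfalso; apply: (nscal c) => m' Mm'.
    have [m1 [Mm1 am1]] := NT (m' i); rewrite comb_coord => m1i.
    have /(inj _ (nclosed_subspaceB Msub Mm' Mm1)) : m' i - m1 i = 0 by rewrite m1i subrr.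
    by move=> /fun_subr_eq0 ->; exact: am1.
have onto c : forall x, exists2 m, M m & comb (a c) m = x.
  by have [/nscal|] := comb_range_trivial n0 Msub Minv (ker c).
have onto_i : forall x, exists2 m, M m & m i = x.
  have [N0|NT] := comb_range_trivial n0 Msub Minv inj_i.
    exfalso; apply: (nscal 0) => m Mm; have /inj_i -> // := N0 _ Mm.
    exact: comb0.
  by move=> x; have [m Mm] := NT x; rewrite comb_coord; exists m.
have [g gM gi] : exists2 g : X -> 'I_n -> X, forall x, M (g x) & forall x, g x i = x.
  have /choice[g gP] : forall x, exists m, M m /\ m i = x.
    by move=> x; have [m] := onto_i x; exists m.
  by exists g => x; have [] := gP x.
have g_uniq m : M m -> g (m i) = m.
  move=> Mm; have /(inj _ (nclosed_subspaceB Msub (gM _) Mm)) : g (m i) i - m i = 0.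
    by rewrite gi subrr.
  exact: fun_subr_eq0.
(* [M] is a graph over its [i]-th coordinate; [T] maps that coordinate to the [j]-th, and
   [comb (a c)] becomes T - c. *)
pose T x := g x j.
have Tlin : linear T.
  move=> c x y; rewrite /T.
  have := g_uniq _ (MD _ _ (MZ c _ (gM x)) (gM y)); rewrite !gi => ->.
  by [].
pose Tl : {linear X -> X} := HB.pack T (GRing.isLinear.Build _ _ _ _ _ Tlin).
have TlE m : M m -> Tl (m i) = m j by move=> Mm; rewrite /= /T g_uniq.
have [x0 x0P] : exists x : X, x <> 0.
  apply: contrapT => noX; apply: (nscal 0) => m _; apply: contrapT => mx; apply: noX.
  by exists (comb (a 0) m).
have onto_i' : forall x, exists2 m, M m & comb (coord i) m = x.
  by move=> x; have [m Mm mi] := onto_i x; exists m => //; rewrite comb_coord.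
have [C C0 CP] := comb_bounded_below Msub onto_i' inj_i.
apply: (@spectrum_nonempty _ _ Tl C x0 x0P).
- move=> x; rewrite -{1}(gi x) TlE//.
  by apply: le_trans (nm_le_norm1 _ _) _; rewrite -{2}(gi x) -comb_coord CP.
- move=> c; have [K K0 KP] := comb_bounded_below Msub (onto c) (ker c).
  exists K => x; rewrite -{1 3}(gi x) -{1}(gi x).
  have := KP _ (gM x); rewrite aE /= /T => /(le_trans _); rewrite !gi.
  by apply; rewrite -{1}(gi x); exact: nm_le_norm1.
- move=> c y; have [m Mm my] := onto c y; exists (m i).
  by rewrite TlE// -aE.
Qed.

(** All coordinates are multiples of the [i]-th, which takes every value since it is not zero on
    [M]. *)
Lemma graph_scalar n (M : set ('I_n -> X)) i :
  nclosed_subspace M -> op_invariant M ->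
  (forall m, M m -> m i = 0 -> m = fun=> 0) ->
  (exists2 m, M m & m i <> 0) ->
  exists v : 'I_n -> R[i], v i = 1 /\ forall x, M (fun j => v j *: x).
Proof.
move=> Msub Minv inj [m0 Mm0 m0i].
have n0 : (0 < n)%N := leq_ltn_trans (leq0n i) (ltn_ord i).
have /choice[v vP] := fun j => coordinate_ratio j Msub Minv inj.
have inj_i m : M m -> comb (coord i) m = 0 -> m = fun=> 0.
  by move=> Mm; rewrite comb_coord; exact: inj.
exists v; split.
  have := vP i _ Mm0; rewrite -{1}[m0 i]scale1r => /eqP.
  rewrite -subr_eq0 -scalerBl scaler_eq0 subr_eq0 => /orP[/eqP//|/eqP//].
move=> x; have [N0|NT] := comb_range_trivial n0 Msub Minv inj_i.
  by exfalso; apply: m0i; rewrite -comb_coord; exact: N0.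
have [m Mm] := NT x; rewrite comb_coord => <-.
by rewrite (_ : (fun j => _) = m)//; apply/funext => j; rewrite -vP.
Qed.

Lemma double_annihilator n (M : set ('I_n -> X)) :
  nclosed_subspace M -> op_invariant M ->
  forall m, (forall c, (forall m', M m' -> comb c m' = 0) -> comb c m = 0) -> M m.
Proof.
(* Induction on the size of a set [s] supporting all of [M]. *)
suff H k (s : {set 'I_n}) : (#|s| < k)%N -> forall M : set ('I_n -> X),
    nclosed_subspace M -> op_invariant M ->
    (forall m, M m -> forall j, j \notin s -> m j = 0) ->
  forall m, (forall c, (forall m', M m' -> comb c m' = 0) -> comb c m = 0) -> M m.
  move=> Msub Minv; apply: (H _ _ (ltnSn #|[set: 'I_n]%SET|)) => //.
  by move=> m _ j; rewrite inE.
elim: k s => // k IH s sk {}M Msub Minv Ms m mP.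
have [M0 MD MZ Mcl] := Msub.
have [Mz|/existsNP[m0 /not_implyP[Mm0 m0_neq0]]] :=
    pselect (forall m', M m' -> m' = fun=> 0).
  rewrite (_ : m = fun=> 0)//; apply/funext => i; rewrite -comb_coord; apply: mP.
  by move=> m' /Mz ->; rewrite comb0.
pose P (t : {set 'I_n}) := `[< exists m', [/\ M m', m' <> (fun=> 0) &
  forall j, j \notin t -> m' j = 0] >].
have Ps : P s by apply/asboolP; exists m0; split=> //; exact: Ms.
have [t /minsetP[/asboolP[m1 [Mm1 m1_neq0 m1t]] tmin] _] := minset_exists Ps.
have [i m1i] : exists i, m1 i <> 0.
  by apply/existsNP => m10; apply: m1_neq0; apply/funext.
have i_t : i \in t by apply/negP => /negP /m1t.
have i_s : i \in s by apply/negP => /negP /(Ms _ Mm1).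
(* These equations cut out the elements of [M] supported in the minimal set [t]. *)
pose D := [set a | exists2 j, j \notin t & a = coord j].
pose M1 := annihilated M D.
have [v [vi Mv]] : exists v : 'I_n -> R[i], v i = 1 /\ forall x, M (fun j => v j *: x).
  have [||m' [Mm' Dm'] m'i||v [vi vM1]] := @graph_scalar _ M1 i.
  - exact: nclosed_annihilated.
  - exact: op_invariant_annihilated.
  (* A non-zero element vanishing at [i] would be supported in [t] without [i], against
     minimality. *)
  - apply: contrapT => m'_neq0; have : (t :\ i)%SET = t.
      apply: tmin; last exact: subD1set.
      apply/asboolP; exists m'; split=> // j; rewrite !inE negb_and negbK.
      case/orP => [/eqP -> //|jt]; rewrite -comb_coord; apply: Dm'.
      by exists j.
    by move=> /setP/(_ i); rewrite !inE eqxx i_t.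
  - exists m1 => //; split=> // _ [j jt ->]; rewrite comb_coord; exact: m1t.
  - by exists v; split=> // x; have [] := vM1 x.
pose M' := annihilated M [set coord i].
have M'_sub m' : M m' -> M' (fun j => m' j - v j *: m' i).
  move=> Mm'; split=> [|_ ->]; first exact: nclosed_subspaceB.
  by rewrite comb_coord vi scale1r subrr.
have M'm : M' (fun j => m j - v j *: m i).
  apply: (IH (s :\ i)%SET).
  - by move: sk; rewrite (cardsD1 i s) i_s.
  - exact: nclosed_annihilated.
  - exact: op_invariant_annihilated.
  - move=> m' [Mm' m'i] j; rewrite !inE negb_and negbK => /orP[/eqP ->|].
      by rewrite -comb_coord; exact: m'i.
    exact: Ms.
  (* Correcting the [i]-th coefficient makes [c] vanish on the multiples of [v]; the result [c']
     holds on all of [M], so [mP] applies. *)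
  move=> c cM'; pose g := \sum_j c j * v j.
  pose c' : 'I_n -> R[i] := fun j => c j - g * coord i j.
  have c'E (m' : 'I_n -> X) : comb c' m' = comb c m' - g *: m' i.
    by rewrite /c' comb_lin comb_coord.
  have c'v (x : X) : comb c' (fun j => v j *: x) = 0.
    rewrite c'E vi scale1r /comb /g scaler_suml -sumrB big1// => j _.
    by rewrite scalerA subrr.
  have c'B (m' : 'I_n -> X) : comb c (fun j => m' j - v j *: m' i) = comb c' m'.
    have := combB c' m' (fun j => v j *: m' i); rewrite c'v subr0 => <-.
    by rewrite c'E vi scale1r subrr scaler0 subr0.
  rewrite c'B; apply: mP => m' Mm'; rewrite -c'B; apply: cM'; exact: M'_sub.
have [Mm _] := M'm; have := MD _ _ Mm (Mv (m i)).
by congr M; apply/funext => j; rewrite subrK.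
Qed.

End InvariantSubspaces.

(** * Density in the weak operator topology *)

Section Density.
Variables (R : realType) (X : completeNormedModType R[i]).

(** The structure fields are propositions, so proof irrelevance identifies them once the functions
    agree. *)
Lemma linear_ext (f g : {linear X -> X}) : f =1 g -> f = g.
Proof.
case: f g => f cf [g cg] /= /funext fg; case: _ / fg in cg *.
congr GRing.Linear.Pack.
case: cf cg => [[f1] [f2]] [[g1] [g2]].
by congr GRing.Linear.Class; [congr Algebra.isNmodMorphism.Axioms_
                             |congr GRing.isScalable.Axioms_]; exact: Prop_irrelevance.
Qed.

Lemma bop_bounded (S : bounded_operator X) :
  exists2 C : R, 0 < C & forall x, nm (bop S x) <= C * nm x.
Proof.
have /linear_boundedP : bounded_near (bop S) (nbhs (0 : X)) := set_valP S.
move=> [C [Creal CP]]; pose B := `|complex.Re C| + 1.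
have B0 : 0 < B by rewrite ltr_pwDr.
exists B => // x; have /CP /(_ x) : C < B%:C%C.
  by rewrite -(RRe_real Creal) ltcR /B; have := ler_norm (complex.Re C); lra.
by rewrite !nmE -rmorphM lecR.
Qed.

(** For a point off the line, compactness bounds its distance to [c *: e] below for [c] in a disc;
    larger [c] give distance at least 1. *)
Lemma line_nclosed (e : X) : nclosed [set m : 'I_1 -> X | exists c, m ord0 = c *: e].
Proof.
move=> l lP; apply: contrapT => ncl.
have [e0|/nm_gt0 e0] := pselect (e = 0).
  apply: ncl; exists 0; rewrite scale0r; apply: contrapT => /nm_gt0 /lP[m [c mc]].
  by move=> /(_ ord0); rewrite mc e0 scaler0 subr0 ltxx.
have far c : 0 < nm (l ord0 - c *: e).
  by apply: nm_gt0 => /eqP; rewrite subr_eq0 => /eqP lc; apply: ncl; exists c.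
have [||K KP] := @disc_uniform R (fun K c => 1 <= K * nm (l ord0 - c *: e))
    ((nm (l ord0) + 1) / nm e).
- move=> K K' c KK' /le_trans; apply.
  by rewrite ler_wpM2r// nm_ge0.
- move=> c; set h := nm (l ord0 - c *: e); have h0 : 0 < h := far c.
  exists (2 / h), (h / 2 / nm e); split; first by rewrite !divr_gt0.
  move=> c'; rewrite ltr_pdivlMr// => cc'.
  have : h <= nm (l ord0 - c' *: e) + nm (c' - c) * nm e.
    rewrite -nmZ; apply: le_trans (nmD _ _).
    by rewrite scalerBl addrA subrK.
  move=> hh; rewrite mulrAC ler_pdivlMr//; lra.
have K1 : 0 < `|K| + 1 by rewrite ltr_pwDr.
have [|m [c mc] /(_ ord0)] := lP (Num.min 1 (`|K| + 1)^-1).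
  by rewrite lt_min ltr01 invr_gt0.
rewrite mc lt_min => /andP[lc1 lcK].
have /KP : nm c <= (nm (l ord0) + 1) / nm e.
  rewrite ler_pdivlMr// -nmZ.
  have := nmB (l ord0) (l ord0 - c *: e); rewrite opprB addrC subrK; lra.
rewrite leNgt => /negP; apply.
apply: le_lt_trans (_ : (`|K| + 1) * nm (l ord0 - c *: e) < _).
  by rewrite ler_wpM2r ?nm_ge0//; have := ler_norm K; lra.
by rewrite -ltr_pdivlMl// mulr1.
Qed.

Variable A : set (bounded_operator X).
Hypothesis A_subalgebra : is_subalgebra A.
Hypothesis A_nondegenerate : ~ (one_dimensional X /\ A = [set bop_zero X]).
Hypothesis A_no_range : ~ exists Y : set X,
  [/\ injective_operator_range Y, invariant_range A Y & nontrivial Y].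

Lemma inj_coord0 (m : 'I_1 -> X) : comb (@coord R 1 ord0) m = 0 -> m = fun=> 0.
Proof. by rewrite comb_coord => m0; apply/funext => j; rewrite ord1. Qed.

(** The common kernel is closed and invariant, hence {0} or X. If it is X, then [A] is zero. *)
Lemma common_kernel_trivial x : (forall S, A S -> bop S x = 0) -> x = 0.
Proof.
move=> Ax; apply: contrapT => x0.
have x'0 : comb (@coord R 1 ord0) (fun=> x) <> 0 by rewrite comb_coord.
have A0 S y : A S -> bop S y = 0.
  move=> AS.
  pose M := [set m : 'I_1 -> X | forall S, A S -> bop S (m ord0) = 0].
  have Msub : nclosed_subspace M.
    split=> [S' _|m m' Mm Mm' S' AS'|c m Mm S' AS'|l lP S' AS'].
    - exact: linear0.
    - by rewrite linearD Mm// Mm'// addr0.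
    - by rewrite linearZ /= Mm// scaler0.
    - have [C C0 CP] := bop_bounded S'.
      apply: contrapT => /nm_gt0 Sl.
      have [|m Mm /(_ ord0) ml] := lP (nm (bop S' (l ord0)) / C).
        by rewrite divr_gt0.
      have := CP (l ord0 - m ord0); rewrite linearB Mm// subr0 => /le_lt_trans.
      by move: ml; rewrite ltr_pdivlMr// mulrC => ml /(_ _ ml); rewrite ltxx.
  have Minv : op_invariant A M.
    move=> S' m AS' Mm S'' AS''; rewrite Mm// linear0//.
  have [N0|NT] := comb_range_trivial A_no_range (ltn0Sn 0) Msub Minv
    (fun m _ => @inj_coord0 m).
    by exfalso; apply/x'0/N0.
  by have [m Mm] := NT y; rewrite comb_coord => <-; exact: Mm.
(* Now every line is invariant, so the line through [x] is all of X. *)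
apply: A_nondegenerate; split.
  exists x => // y.
  pose L := [set m : 'I_1 -> X | exists c, m ord0 = c *: x].
  have Lsub : nclosed_subspace L.
    split; last exact: line_nclosed.
    - by exists 0; rewrite scale0r.
    - by move=> m m' [c mc] [c' mc']; exists (c + c'); rewrite mc mc' scalerDl.
    - by move=> c m [c' mc']; exists (c * c'); rewrite mc' scalerA.
  have Linv : op_invariant A L.
    by move=> S m AS _; exists 0; rewrite A0// scale0r.
  have [N0|NT] := comb_range_trivial A_no_range (ltn0Sn 0) Lsub Linv
    (fun m _ => @inj_coord0 m).
    by exfalso; apply/x'0/N0; exists 1; rewrite scale1r.
  by have [m [c mc]] := NT y; rewrite comb_coord mc => <-; exists c.
apply/seteqP; split=> S /=.
  by move=> AS; apply: val_inj; apply: linear_ext => y; exact: A0.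
by move=> ->; have [] := A_subalgebra.
Qed.

(** This is density in the strong operator topology. *)
Lemma pointwise_approximation n (x : 'I_n -> X) (T : bounded_operator X) (e : R) :
  0 < e -> exists2 S, A S & forall i, nm (bop T (x i) - bop S (x i)) < e.
Proof.
have [A0 AD AZ AM] := A_subalgebra.
(* The closure of the orbit of the tuple [x], invariant because [A] is closed under composition. *)
pose M := [set l : 'I_n -> X | forall e : R, 0 < e ->
  exists2 S, A S & forall i, nm (l i - bop S (x i)) < e].
have Mx S : A S -> M (fun i => bop S (x i)).
  by move=> AS d d0; exists S => // i; rewrite subrr nm0.
suff : M (fun i => bop T (x i)) by apply.
have Msub : nclosed_subspace M.
  split=> [|l l' Ml Ml' d d0|c l Ml d d0|l lP d d0].
  - exact: Mx A0.
  - have d20 : 0 < d / 2 by rewrite divr_gt0.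
    have [S AS Sl] := Ml _ d20; have [S' AS' Sl'] := Ml' _ d20.
    exists (bop_add S S') => [|i]; first exact: AD.
    rewrite /= opprD addrACA; apply: le_lt_trans (nmD _ _) _.
    by have := Sl i; have := Sl' i; lra.
  - have c1 : 0 < nm c + 1 by rewrite ltr_pwDr// nm_ge0.
    have [|S AS Sl] := Ml (d / (nm c + 1)); first by rewrite divr_gt0.
    exists (bop_scale c S) => [|i]; first exact: AZ.
    rewrite /= -scalerBr nmZ; have := Sl i; rewrite ltr_pdivlMr//.
    have := nm_ge0 (l i - bop S (x i)); lra.
  - have d20 : 0 < d / 2 by rewrite divr_gt0.
    have [m Mm ml] := lP _ d20; have [S AS Sm] := Mm _ d20.
    exists S => // i; have -> : l i - bop S (x i) = (l i - m i) + (m i - bop S (x i)).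
      by rewrite addrA subrK.
    apply: le_lt_trans (nmD _ _) _; have := ml i; have := Sm i; lra.
have Minv : op_invariant A M.
  move=> S m AS Mm d d0; have [C C0 CP] := bop_bounded S.
  have [|S' AS' Sm] := Mm (d / C); first by rewrite divr_gt0.
  exists (bop_comp S S') => [|i]; first exact: AM.
  rewrite /= -linearB; apply: le_lt_trans (CP _) _.
  by have := Sm i; rewrite ltr_pdivlMr// mulrC.
apply: (double_annihilator A_no_range Msub Minv) => c cM.
have cx : comb c x = 0.
  by apply: common_kernel_trivial => S AS; rewrite bop_comb; apply: cM; exact: Mx.
by have := bop_comb c T x; rewrite cx linear0.
Qed.

Lemma subalgebra_dense : dense (A : set (wot X)).
Proof.
move=> O [T OT] Oopen.
(* The filter of elements of [A] close to [T] at finitely many points. It converges weakly to [T],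
   so it contains [O]; [pointwise_approximation] makes its members non-empty. *)
pose F : set_system (wot X) := [set P | exists (s : seq X) (e : R), 0 < e /\
  [set S | A S /\ forall x, x \in s -> nm (bop T x - bop S x) < e] `<=` P].
have FF : Filter F.
  split.
  - by exists [::], 1.
  - move=> P Q [s [e [e0 sP]]] [s' [e' [e'0 sQ]]].
    exists (s ++ s'), (Num.min e e'); split; first by rewrite lt_min e0.
    move=> S [AS Ss]; split; [apply: sP|apply: sQ]; split=> // x xs.
      by have := Ss x; rewrite mem_cat xs => /(_ isT); rewrite lt_min => /andP[].
    by have := Ss x; rewrite mem_cat xs orbT => /(_ isT); rewrite lt_min => /andP[].
  - move=> P Q PQ [s [e [e0 sP]]]; exists s, e; split=> //.
    exact: subset_trans PQ.
have FA : F A by exists [::], 1; split=> // S [].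
have Fcvg : wot_eval (X := X) @ F --> wot_eval T.
  apply/cvg_sup => -[x f]; apply/cvg_image.
    (* Evaluation at (x, f) must be onto; constant families show it. *)
    by rewrite eqEsubset; split=> v // _; exists (cst v).
  move=> U; rewrite /= nbhs_simpl => nU.
  exists ((fun g => g (x, f)) @^-1` U); last first.
    by rewrite image_preimage// eqEsubset; split=> v // _; exists (cst v).
  have /nbhs_normP[d d0 dU] : nbhs (bop T x) (sval f @^-1` U).
    exact: (svalP f (bop T x) U nU).
  have dE : d = (complex.Re d)%:C%C by rewrite RRe_real// gtr0_real.
  exists [:: x], (complex.Re d); split; first by rewrite -ltcR -dE.
  move=> S [AS /(_ x (mem_head _ _))]; rewrite -ltcR -nmE -dE; exact: dU.
have [U [[B Bopen BU] UT UO]] : nbhs (T : wot X) O by exact: open_nbhs_nbhs.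
have FO : F O.
  apply: filterS UO _; rewrite -BU.
  apply: Fcvg; apply: open_nbhs_nbhs; split=> //.
  by move: UT; rewrite -BU.
have [s [e [e0 sOA]]] : F (O `&` A) := filterI FO FA.
have [S AS Se] := pointwise_approximation (fun i : 'I_(size s) => nth 0 s i) T e0.
exists S; apply: sOA; split=> // x xs.
have xi : (index x s < size s)%N by rewrite index_mem.
by have := Se (Ordinal xi); rewrite /= nth_index.
Qed.
End Density.

(* On a one-dimensional X the zero subalgebra has no non-trivial invariant
   operator range, yet is not dense; A_nondegenerate excludes only this case. *)
Theorem corollary4p3 (R : realType) (X : completeNormedModType R[i])
    (A : set (bounded_operator X)) (A_subalgebra : is_subalgebra A)
    (A_nondegenerate : ~ (one_dimensional X /\ A = [set bop_zero X]))
    (A_no_range : ~ exists Y : set X,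
      [/\ injective_operator_range Y, invariant_range A Y & nontrivial Y]) :
  dense (A : set (wot X)).
Proof. exact: subalgebra_dense. Qed.
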